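(* Let $n,k$ be integers with $0 \le k < n$ and let $\delta < 1/3$. Any randomised one-way communication protocol (Alice sends a single message to Bob) that solves $\textsf{BInd}^{n,k}_\delta$ must communicate $\Omega((n-k)^2)$ bits.
   Context: Write $[m]=\{1,\dots,m\}$. The problem $\textsf{BInd}^{n,k}_\delta$ (Augmented Bi-Index) is the following one-way two-party communication problem. Alice holds a binary matrix $A\in\{0,1\}^{n\times n}$. Bob holds indices $x,y\in[n-k]$ and the entries $A_{S(x,y)}=(A_{i,j})_{(i,j)\in S(x,y)}$, where $S(x,y)=\{(i,j)\in[n]^2 : x\le i<x+k,\ y\le j<y+k\}\setminus\{(x,y)\}$. Alice sends a single message $M$ to Bob, who must output $A_{x,y}$ with probability at least $1-\delta$ (for every input). The communication cost is the maximum length in bits of $M$. *)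

(* Defs.v *)
(* MathComp / MathComp-Analysis *)
From HB Require Import structures.
From mathcomp Require Import all_boot all_order all_algebra.
From mathcomp Require Import all_classical all_reals all_analysis.

Set Implicit Arguments.
Unset Strict Implicit.
Unset Printing Implicit Defensive.

Import Order.TTheory GRing.Theory Num.Theory.
Local Open Scope classical_set_scope.
Local Open Scope ring_scope.

(* The sample point w is visible to both players (public coins).  Private coins
   are the special case where Omega is a product and each player only reads
   its own factor, so a lower bound in this model covers both.  The
   measurability fields say that messages and answers are (discrete) random
   variables. *)
Record one_way_protocol (d : measure_display) (Omega : measurableType d)
    (X Y : Type) := OneWayProtocol {
  alice : Omega -> X -> seq bool;
  bob : Omega -> seq bool -> Y -> bool;
  measurable_alice : forall (a : X) (m : seq bool),
    measurable [set w | alice w a = m];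
  measurable_bob : forall (m : seq bool) (b : Y) (z : bool),
    measurable [set w | bob w m b = z] }.

(* Maximum message length; it is +oo when the lengths are unbounded. *)
Definition cost (R : realType) (d : measure_display) (Omega : measurableType d)
    (X Y : Type) (Pi : one_way_protocol Omega X Y) : \bar R :=
  ereal_sup [set ((size (alice Pi p.1 p.2))%:R : R)%:E | p in [set: Omega * X]].

Section BInd.
Variables n k : nat.

(* Indices are 0-based: [n] is 'I_n and [n - k] is 'I_(n - k). *)
Definition target (x y : 'I_(n - k)) : 'I_n * 'I_n :=
  (widen_ord (leq_subr k n) x, widen_ord (leq_subr k n) y).

Definition window (x y : 'I_(n - k)) : {set 'I_n * 'I_n} :=
  [set p : 'I_n * 'I_n |
    (x <= p.1 < x + k)%N && (y <= p.2 < y + k)%N] :\ target x y.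

Record bob_input := BobInput {
  row_index : 'I_(n - k);
  col_index : 'I_(n - k);
  known : {ffun {p : 'I_n * 'I_n | p \in window row_index col_index} -> bool} }.

Definition bob_view (A : 'M[bool]_n) (x y : 'I_(n - k)) : bob_input :=
  @BobInput x y [ffun p => A (val p).1 (val p).2].

Definition solves_BInd (R : realType) (d : measure_display)
    (Omega : measurableType d) (P : probability Omega R) (delta : R)
    (Pi : one_way_protocol Omega 'M[bool]_n bob_input) : Prop :=
  forall (A : 'M[bool]_n) (x y : 'I_(n - k)),
    ((1 - delta)%:E <=
     P [set w | bob Pi w (alice Pi w A) (bob_view A x y)
                = A (target x y).1 (target x y).2])%E.

End BInd.

(* Main.v *)
(* Restrict to matrices supported on the (n-k) x (n-k) corner, N = (n-k)^2 bits,
   and fix by averaging a sample point for which Bob errs on at most a third of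
   the pairs (matrix, cell).  Processing the cells by decreasing x + y, every
   window S(x,y) is known before A_{x,y}, so the message together with the set
   of cells where Bob errs determines the matrix.  If M messages are available,
   the sum over matrices of 2^-errors is thus at most M (3/2)^N, while by AM-GM
   it is at least 2^N 2^(-N/3); hence M^3 >= (32/27)^N. *)
Require Import Defs.
From HB Require Import structures.
From mathcomp Require Import all_boot all_order all_algebra.
From mathcomp Require Import all_classical all_reals all_analysis.
From mathcomp Require Import measurable_realfun lra zify.
Import Order.TTheory GRing.Theory Num.Theory.
Local Open Scope classical_set_scope.
Local Open Scope ring_scope.

(** The expected number of events containing [w] is the sum of their probabilities, so it cannot
    stay below [s * #|J|] everywhere. The gap [s < t] lets the pointwise strict bound be weakened
    before integrating. *)
Lemma exists_in_many_events (R : realType) (d : measure_display)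
    (Omega : measurableType d) (P : probability Omega R) (J : finType)
    (E : J -> set Omega) (s t : R) :
  (0 < #|J|)%N -> s < t -> (forall j, measurable (E j)) ->
  (forall j, (t%:E <= P (E j))%E) ->
  exists w, s * #|J|%:R <= \sum_j (w \in E j)%:R.
Proof.
move=> J_gt0 lt_st mE tE; apply: contrapT => /forallNP few.
have few_le w : \sum_j (w \in E j)%:R <= s * #|J|%:R.
  by have /negP := few w; rewrite -ltNge => /ltW.
have int_sum : (\int[P]_(w in setT) (\sum_j (\1_(E j) w)%:E) = \sum_j P (E j))%E.
  rewrite ge0_integral_sum //=; last first.
    by move=> j; apply/measurable_EFinP; exact: measurable_indic.
  by apply: eq_bigr => j _; rewrite integral_indic ?setIT.
have : (\sum_j P (E j) <= (s * #|J|%:R)%:E)%E.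
  rewrite -int_sum -[leRHS]mule1 -(probability_setT P) -integral_cst //.
  apply: ge0_le_integral => //.
  - by move=> w _; apply: sume_ge0 => j _; rewrite lee_fin.
  - apply: emeasurable_sum => j; apply/measurable_EFinP.
    exact: measurable_indic.
  - move=> w _; rewrite sumEFin lee_fin; under eq_bigr do rewrite indicE.
    exact: few_le.
have : ((t * #|J|%:R)%:E <= \sum_j P (E j))%E.
  rewrite mulrC mulr_natl -sumr_const -sumEFin.
  by apply: lee_sum => j _; exact: tE.
move=> le1 le2; have := le_trans le1 le2.
by rewrite lee_fin ler_pM2r ?ltr0n // leNgt lt_st.
Qed.

Section Prediction.
Variables (I Msg : finType) (rank : I -> nat).
Variable msg : {ffun I -> bool} -> Msg.
Variable guess : Msg -> {ffun I -> bool} -> I -> bool.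
(** [guess] is handed a whole assignment, which avoids a type of partial ones; causality says that
    it reads only the bits of smaller rank. *)
Hypothesis guess_causal : forall (m : Msg) (A B : {ffun I -> bool}) i,
  (forall j, (rank j < rank i)%N -> A j = B j) -> guess m A i = guess m B i.

Definition mispredicted (A : {ffun I -> bool}) : {ffun I -> bool} :=
  [ffun i => guess (msg A) A i != A i].

(** Decoding goes by strong induction on the rank: agreement on smaller ranks gives equal guesses,
    and the error bit then fixes the bit itself. *)
Lemma msg_mispredicted_inj : injective (fun A => (msg A, mispredicted A)).
Proof.
move=> A B [eq_msg eq_err]; apply/ffunP => i.
have [r] := ubnP (rank i); elim: r i => // r IHr i lt_ir.
have eq_guess : guess (msg A) A i = guess (msg B) B i.
  rewrite -eq_msg; apply: guess_causal => j lt_ji.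
  by apply: IHr; apply: leq_trans lt_ji _.
have := congr1 (fun e : {ffun I -> bool} => e i) eq_err.
by rewrite !ffunE eq_guess; case: (guess _ _ _) (A i) (B i) => -[] [].
Qed.

(** By injectivity the sum is at most the one over all pairs of a message and an error pattern,
    where the weight enumerator of the patterns factors over [I]. *)
Lemma sum_exp_mispredicted (R : realFieldType) (t : R) : 0 <= t ->
  \sum_A t ^+ (\sum_i mispredicted A i) <= #|Msg|%:R * (1 + t) ^+ #|I|.
Proof.
move=> t_ge0.
pose F (p : Msg * {ffun I -> bool}) := t ^+ (\sum_i p.2 i).
pose codes := [set (msg A, mispredicted A) | A in {: {ffun I -> bool}}]%SET.
have -> : \sum_A t ^+ (\sum_i mispredicted A i) = \sum_(p in codes) F p.
  by rewrite big_imset //= => A B _ _; exact: msg_mispredicted_inj.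
apply: (@le_trans _ _ (\sum_p F p)).
  rewrite [leRHS](bigID (mem codes)) /=.
  by rewrite lerDl sumr_ge0 // => p _; rewrite exprn_ge0.
rewrite -(pair_bigA _ (fun m e => F (m, e))) /F /= sumr_const -[leLHS]mulr_natl.
rewrite ler_wpM2l //.
under eq_bigr do rewrite -prodrXr.
rewrite -(bigA_distr_bigA (fun (_ : I) (b : bool) => t ^+ b)).
by rewrite prodr_const big_bool /= expr1 expr0 addrC.
Qed.

Lemma card_msg_ge (R : realFieldType) :
  (3 * (\sum_A \sum_i mispredicted A i) <= #|I| * 2 ^ #|I|)%N ->
  (32 / 27) ^+ #|I| <= #|Msg|%:R ^+ 3 :> R.
Proof.
move=> few_err.
set N := #|I| in few_err *; set K := (2 ^ N)%N in few_err.
have cardK : #|{ffun I -> bool}| = K by rewrite card_ffun card_bool.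
have K_gt0 : (0 < K)%N by rewrite expn_gt0.
(* For error rate 1/3, the weight t = 1/2 minimises (1 + t) / t^(1/3), hence gives the best
   bound. *)
pose avg : R := (\sum_A (1 / 2) ^+ (\sum_i mispredicted A i)) / K%:R.
have avg_ge0 : 0 <= avg.
  by rewrite divr_ge0 // sumr_ge0 // => A _; rewrite exprn_ge0 // divr_ge0.
have half_ge0 : 0 <= 1 / 2 :> R by lra.
have avg_ge : (1 / 2) ^+ N <= avg ^+ 3.
  (* AM-GM bounds a product by [avg ^+ K]; taking [K]-th powers avoids roots, just as the cube
     avoids the exponent N/3. *)
  rewrite -(ler_pXn2r K_gt0) ?nnegrE ?exprn_ge0 //.
  have [AGM _] := @leif_AGM R _ {: {ffun I -> bool}}
    (fun A => (1 / 2) ^+ (\sum_i mispredicted A i)) (fun A _ => exprn_ge0 _ half_ge0).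
  rewrite cardK -/avg prodrXr in AGM.
  rewrite (exprAC avg).
  apply: (@le_trans _ _ (((1 / 2) ^+ (\sum_A \sum_i mispredicted A i)) ^+ 3)).
    by rewrite -!exprM; apply: ler_wiXn2l; [lra|lra|rewrite mulnC].
  by rewrite ler_pXn2r ?nnegrE ?exprn_ge0.
have avg_le : avg <= #|Msg|%:R * (3 / 4) ^+ N.
  rewrite ler_pdivrMr ?ltr0n // -mulrA natrX -exprMn.
  have -> : 3 / 4 * 2%:R = 1 + 1 / 2 :> R by lra.
  by apply: sum_exp_mispredicted; lra.
have : (1 / 2) ^+ N <= #|Msg|%:R ^+ 3 * (27 / 64) ^+ N :> R.
  apply: (le_trans avg_ge); move: (avg) avg_ge0 avg_le => a a_ge0 a_le.
  have -> : (27 / 64 : R) = (3 / 4) ^+ 3 by lra.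
  rewrite (exprAC (3 / 4)) -exprMn lerXn2r ?nnegrE ?mulr_ge0 ?exprn_ge0 //; lra.
have -> : (1 / 2 : R) = 32 / 27 * (27 / 64) by lra.
by rewrite exprMn ler_pM2r // exprn_gt0 //; lra.
Qed.

End Prediction.

(** The exact count is 2^(c+1) - 1. The bound 4^c is still 1 at c = 0, so no additive constant
    enters later. *)
Lemma card_bseq_bool_le (c : nat) : (#|{: c.-bseq bool}| <= 4 ^ c)%N.
Proof.
have := predn_exp 2 c.+1.
rewrite card_bseq card_bool mul1n => <-.
elim: c => // c IHc; rewrite !expnS in IHc *.
by have : (0 < 2 ^ c)%N; [rewrite expn_gt0|lia].
Qed.

Lemma le_of_card_bseq (R : realFieldType) (N c : nat) :
  (32 / 27) ^+ N <= #|{: c.-bseq bool}|%:R ^+ 3 :> R -> (N <= 30 * c)%N.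
Proof.
move=> le_card; rewrite -(@ler_eXn2l _ (32 / 27 : R)); last lra.
apply: (le_trans le_card); rewrite exprM.
apply: (@le_trans _ _ (((4 ^ c)%N%:R : R) ^+ 3)).
  by rewrite lerXn2r ?nnegrE // ler_nat card_bseq_bool_le.
(* The constant 30 comes from 4^3 <= (32/27)^30. *)
rewrite natrX exprAC lerXn2r ?nnegrE ?exprn_ge0 //; lra.
Qed.

Section BInd.
Variables (n k : nat).
Local Notation cell := ('I_(n - k) * 'I_(n - k))%type.

Definition pad (A : {ffun cell -> bool}) : 'M[bool]_n :=
  \matrix_(i, j) (if (insub (val i), insub (val j)) is (Some x, Some y)
                  then A (x, y) else false).

Lemma pad_target (A : {ffun cell -> bool}) (x y : 'I_(n - k)) :
  pad A (target x y).1 (target x y).2 = A (x, y).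
Proof. by rewrite mxE /= !valK. Qed.

(** Larger coordinate sums come first; the subtractions are exact since coordinates are below
    [n]. *)
Definition antidiagonal_rank (p : cell) : nat := (n - p.1 + (n - p.2))%N.

(** A window cell exceeds (x, y) in some coordinate and is below it in none, so its rank is smaller;
    outside the corner both paddings are [false]. *)
Lemma bob_view_causal (A B : {ffun cell -> bool}) (x y : 'I_(n - k)) :
  (forall q, (antidiagonal_rank q < antidiagonal_rank (x, y))%N -> A q = B q) ->
  bob_view (pad A) x y = bob_view (pad B) x y.
Proof.
move=> eqAB; congr BobInput; apply/ffunP => -[[i j] win]; rewrite !ffunE !mxE /=.
move: win; rewrite !inE /target /= xpair_eqE -!val_eqE /= => win.
case: insubP => // x' _ ex; case: insubP => // y' _ ey.
apply: eqAB; rewrite /antidiagonal_rank /= ex ey.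
have := ltn_ord i; have := ltn_ord j; have := ltn_ord x; have := ltn_ord y.
lia.
Qed.

(** There are countably many messages, so the event splits into a countable union over the message
    sent. *)
Lemma measurable_answer (d : measure_display) (Omega : measurableType d)
    (X Y : Type) (Pi : one_way_protocol Omega X Y) (a : X) (b : Y) (z : bool) :
  measurable [set w | bob Pi w (alice Pi w a) b = z].
Proof.
have -> : [set w | bob Pi w (alice Pi w a) b = z] =
    \bigcup_(m : seq bool)
      ([set w | alice Pi w a = m] `&` [set w | bob Pi w m b = z]).
  apply/seteqP; split => w /=; first by move=> <-; exists (alice Pi w a).
  by move=> [m _ [/= <-]].
apply: countable_bigcupT_measurable => // m.
by apply: measurableI; [exact: measurable_alice | exact: measurable_bob].
Qed.

Lemma BInd_message_length (R : realType) (delta : R) (d : measure_display)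
    (Omega : measurableType d) (P : probability Omega R)
    (Pi : one_way_protocol Omega 'M[bool]_n (bob_input n k)) (c : nat) :
  (k < n)%N -> delta < 1 / 3 -> solves_BInd P delta Pi ->
  (forall w A, size (alice Pi w A) <= c)%N -> ((n - k) ^ 2 <= 30 * c)%N.
Proof.
move=> lt_kn lt_delta Pi_ok le_c.
have cardI : #|{: cell}| = ((n - k) ^ 2)%N by rewrite card_prod card_ord.
pose E (p : {ffun cell -> bool} * cell) := [set w |
  bob Pi w (alice Pi w (pad p.1)) (bob_view (pad p.1) p.2.1 p.2.2) = p.1 p.2].
have [||||w many] := @exists_in_many_events R d Omega P _ E (2 / 3) (1 - delta).
- by rewrite card_prod cardI card_ffun muln_gt0 !expn_gt0 card_bool subn_gt0 lt_kn.
- lra.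
- by move=> p; exact: measurable_answer.
- by move=> [A [x y]]; have := Pi_ok (pad A) x y; rewrite pad_target.
(* With [w] fixed the protocol is deterministic, and the length bound makes the message type
   finite. *)
pose msg A : c.-bseq bool := Bseq (le_c w (pad A)).
pose guess (m : c.-bseq bool) A (p : cell) := bob Pi w m (bob_view (pad A) p.1 p.2).
rewrite -cardI; apply: (@le_of_card_bseq R).
apply: (@card_msg_ge _ _ antidiagonal_rank msg guess).
  by move=> m A B [x y] eqAB; rewrite /guess (bob_view_causal _ _ _ _ eqAB).
have err_compl : (\sum_A \sum_i mispredicted _ _ msg guess A i + \sum_p (w \in E p)
    = #|{: {ffun cell -> bool} * cell}|)%N.
  rewrite pair_bigA -big_split /= -sum1_card; apply: eq_bigr => -[A p] _ /=.
  rewrite ffunE /guess /E /=.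
  have -> : (w \in E (A, p)) = (guess (msg A) A p == A p).
    by apply/idP/eqP; rewrite inE.
  by case: eqP.
rewrite -natr_sum in many.
have {many} : (2 * #|{: {ffun cell -> bool} * cell}| <= 3 * \sum_p (w \in E p))%N.
  by rewrite -(ler_nat R) !natrM; lra.
by move: err_compl; rewrite card_prod card_ffun card_bool; lia.
Qed.

End BInd.

Theorem theorem2 (R : realType) :
  exists2 C : R, 0 < C &
    forall (n k : nat) (delta : R), (k < n)%N -> delta < 1 / 3 ->
    forall (d : measure_display) (Omega : measurableType d)
           (P : probability Omega R)
           (Pi : one_way_protocol Omega 'M[bool]_n (bob_input n k)),
      solves_BInd P delta Pi ->
      ((C * ((n - k) ^ 2)%N%:R)%:E <= cost R Pi)%E.
Proof.
exists (1 / 30); first lra.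
(* Arguing by contradiction also settles infinite cost: [short] bounds all message lengths. *)
move=> n k delta lt_kn lt_delta d Omega P Pi Pi_ok; rewrite leNgt; apply/negP => short.
have N_gt0 : (0 < (n - k) ^ 2)%N by rewrite expn_gt0 subn_gt0 lt_kn.
have size_lt w A : (30 * size (alice Pi w A) < (n - k) ^ 2)%N.
  have : ((size (alice Pi w A))%:R%:E <= cost R Pi)%E.
    by apply: ereal_sup_ubound; exists (w, A).
  by move=> /le_lt_trans/(_ short); rewrite lte_fin -(ltr_nat R) natrM; lra.
(* This is the largest [c] with 30 c < (n - k)^2, contradicting the lemma's conclusion. *)
have := @BInd_message_length n k R delta d Omega P Pi (((n - k) ^ 2).-1 %/ 30)
  lt_kn lt_delta Pi_ok.
suff le_c w A : (size (alice Pi w A) <= ((n - k) ^ 2).-1 %/ 30)%N by move=> /(_ le_c); lia.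
by have := size_lt w A; lia.
Qed.
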